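(* Let $\mathcal C$ and $\mathcal S$ be finite sets and, for each $s\in\mathcal S$, let $p_s(\cdot)$ be a probability distribution on $\mathcal C$. Suppose there exists a function $\psi:\mathcal C\to\mathbb R$ such that for every $s\in\mathcal S$, $$\mathbb E_{(s)}[\psi(C)]=0\quad\text{and}\quad \mathrm{Var}_{(s)}[\psi(C)]>0,$$ where $\mathbb E_{(s)}$ and $\mathrm{Var}_{(s)}$ denote expectation and variance when $C$ has distribution $p_s$. Then deterministic randomness extraction from the generalized SV source with respect to the distributions $\{p_s\}_{s\in\mathcal S}$ is possible.
   Context: Generalized SV source: a sequence $C_1,C_2,\dots$ of $\mathcal C$-valued random variables generated as follows. At each step $i$, an adversary chooses $S_i=s_i\in\mathcal S$, possibly randomly, depending only on $C_1,\dots,C_{i-1}$; then $C_i$ is sampled from $p_{s_i}$. Any such rule for the adversary is called a strategy. Deterministic randomness extraction from this source is possible if for every $\epsilon>0$ there exist $n$ and a function $\Gamma_n:\mathcal C^n\to\{0,1\}$ such that, for every strategy of the adversary, the distribution of $\Gamma_n(C_1,\dots,C_n)$ is within total variation distance $\epsilon$ of the uniform distribution on $\{0,1\}$. *)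

(* Defs.v *)
From HB Require Import structures.
From mathcomp Require Import all_boot all_order all_algebra.
From mathcomp Require Import reals.

Set Implicit Arguments.
Unset Strict Implicit.
Unset Printing Implicit Defensive.

Import Order.TTheory GRing.Theory Num.Theory.
Local Open Scope ring_scope.

Record fdist (R : realType) (A : finType) := FDist {
  pmf :> A -> R;
  pmf_ge0 : forall a, 0 <= pmf a;
  pmf_sum1 : \sum_(a : A) pmf a = 1 }.

Definition expectation (R : realType) (A : finType) (P : fdist R A)
    (f : A -> R) : R :=
  \sum_(a : A) P a * f a.

Definition variance (R : realType) (A : finType) (P : fdist R A)
    (f : A -> R) : R :=
  expectation P (fun a => (f a - expectation P f) ^+ 2).

Definition tv_distance (R : realType) (A : finType) (P Q : A -> R) : R :=
  2^-1 * \sum_(a : A) `|P a - Q a|.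

Definition uniform_bit (R : realType) (b : bool) : R := 2^-1.

(* The history [:: C_1; ...; C_(i-1)] determines the law of the (possibly
   randomized) choice S_i; deterministic rules are the point masses. *)
Definition strategy (R : realType) (C S : finType) : Type :=
  seq C -> fdist R S.

Section GeneralizedSV.
Context (R : realType) (C S : finType) (p : S -> fdist R C).

(* P(S_1 = s_1, C_1 = c_1, ..., S_n = s_n, C_n = c_n); the history seen at the
   0-based index i is take i c. *)
Definition joint_law (sigma : strategy R C S) (n : nat)
    (s : n.-tuple S) (c : n.-tuple C) : R :=
  \prod_(i < n) (sigma (take i c) (tnth s i) * p (tnth s i) (tnth c i)).

Definition source_law (sigma : strategy R C S) (n : nat)
    (c : n.-tuple C) : R :=
  \sum_(s : n.-tuple S) joint_law sigma s c.

Definition output_law (sigma : strategy R C S) (n : nat)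
    (Gamma : n.-tuple C -> bool) (b : bool) : R :=
  \sum_(c : n.-tuple C | Gamma c == b) source_law sigma c.

(* The extractor Gamma is fixed before the strategy is quantified over. *)
Definition deterministic_extraction_possible : Prop :=
  forall eps : R, 0 < eps ->
    exists (n : nat) (Gamma : n.-tuple C -> bool),
      forall sigma : strategy R C S,
        tv_distance (output_law sigma Gamma) (@uniform_bit R) <= eps.

End GeneralizedSV.

(* Main.v *)
(** Stop the martingale [psi C_1 + ... + psi C_i] as soon as it leaves the
    interval [(-a, a)], and output the sign of its final value.  Whatever the
    adversary does, the stopped value has mean [0] and lies within
    [B >= max |psi|] of [a] or [-a], unless the walk is still running; hence
    both signs have probability [1/2] up to [O(B / a)].  The second moment of
    the walk grows by at least [v = min_s Var_s psi] per step while it runs and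
    is bounded by [(a + B)^2], so that the walk is still running after [n] steps
    with probability at most [(a + B)^2 / (n v)]. *)
Require Import Defs.
From HB Require Import structures.
From mathcomp Require Import all_boot all_order all_algebra.
From mathcomp Require Import reals.
From mathcomp Require Import ring lra.

Set Implicit Arguments.
Unset Strict Implicit.
Unset Printing Implicit Defensive.

Import Order.TTheory GRing.Theory Num.Theory.
Local Open Scope ring_scope.

(** * Expectations under the source, by recursion on the first symbol *)

Lemma big_tuple_cons (R : nmodType) (T : finType) (n : nat)
    (F : n.+1.-tuple T -> R) :
  \sum_t F t = \sum_x \sum_(t : n.-tuple T) F [tuple of x :: t].
Proof.
rewrite pair_big /=.
rewrite (reindex (fun u : T * n.-tuple T => [tuple of u.1 :: u.2])) //=.
exists (fun t => (thead t, [tuple of behead t])) => [[x t] _|t _] /=.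
  by congr (_, _); apply: val_inj.
by rewrite -tuple_eta.
Qed.

Section SourceMean.
Context (R : realType) (C S : finType) (p : S -> fdist R C).
Implicit Types (sigma : strategy R C S) (f g : seq C -> R).

(** After a first symbol [x] there remains a source with the same [p], driven by this strategy;
    hence the inductions on [n] generalize [sigma]. *)
Definition shift_strategy sigma (x : C) : strategy R C S :=
  fun h => sigma (x :: h).

Definition first_law sigma (x : C) : R := \sum_s sigma [::] s * p s x.

(** [f] lives on sequences, so that one function serves all lengths and [fun c => f (x :: c)] needs
    no cast. *)
Definition source_mean sigma (n : nat) f : R :=
  \sum_(c : n.-tuple C) source_law p sigma c * f c.

Lemma source_law_cons sigma n (x : C) (c : n.-tuple C) :
  source_law p sigma [tuple of x :: c] =
  first_law sigma x * source_law p (shift_strategy sigma x) c.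
Proof.
rewrite /source_law big_tuple_cons /first_law big_distrlr /=.
apply: eq_bigr => s _; apply: eq_bigr => t _.
rewrite /joint_law big_ord_recl /=; congr (_ * _).
by apply: eq_bigr => i _; rewrite !tnthS.
Qed.

Lemma source_mean0 sigma f : source_mean sigma 0 f = f [::].
Proof.
rewrite /source_mean (big_pred1 [tuple]) => [|c]; last by apply/esym/eqP/tuple0.
rewrite /source_law (big_pred1 [tuple]) => [|s]; last by apply/esym/eqP/tuple0.
by rewrite /joint_law big_ord0 mul1r.
Qed.

Lemma source_meanS sigma n f :
  source_mean sigma n.+1 f =
  \sum_x first_law sigma x *
    source_mean (shift_strategy sigma x) n (fun c => f (x :: c)).
Proof.
rewrite /source_mean big_tuple_cons; apply: eq_bigr => x _.
rewrite big_distrr; apply: eq_bigr => c _ /=.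
by rewrite source_law_cons mulrA.
Qed.

Lemma first_law_ge0 sigma x : 0 <= first_law sigma x.
Proof. by apply: sumr_ge0 => s _; rewrite mulr_ge0 ?pmf_ge0. Qed.

(** The first symbol follows a mixture of the [p s], so a bound uniform in [s] survives any choice
    of the adversary. *)
Lemma first_law_mean sigma (h : C -> R) :
  \sum_x first_law sigma x * h x = \sum_s sigma [::] s * expectation (p s) h.
Proof.
under eq_bigr do rewrite big_distrl.
rewrite exchange_big; apply: eq_bigr => s _ /=.
by rewrite big_distrr; apply: eq_bigr => x _ /=; rewrite mulrA.
Qed.

Lemma first_law_sum1 sigma : \sum_x first_law sigma x = 1.
Proof.
have := first_law_mean sigma (fun=> 1).
under eq_bigr do rewrite /= mulr1.
move=> ->; rewrite -[RHS](pmf_sum1 (sigma [::])); apply: eq_bigr => s _.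
rewrite /expectation; under eq_bigr do rewrite /= mulr1.
by rewrite pmf_sum1 mulr1.
Qed.

Lemma source_law_ge0 sigma n (c : n.-tuple C) : 0 <= source_law p sigma c.
Proof.
apply: sumr_ge0 => s _; apply: prodr_ge0 => i _.
by rewrite mulr_ge0 ?pmf_ge0.
Qed.

Lemma source_mean_cst sigma n (k : R) : source_mean sigma n (fun=> k) = k.
Proof.
elim: n sigma => [|n IHn] sigma; first exact: source_mean0.
rewrite source_meanS; under eq_bigr do rewrite IHn.
by rewrite -big_distrl /= first_law_sum1 mul1r.
Qed.

Lemma eq_source_mean sigma n f g :
  f =1 g -> source_mean sigma n f = source_mean sigma n g.
Proof. by move=> fg; apply: eq_bigr => c _; rewrite fg. Qed.

Lemma source_meanD sigma n f g :
  source_mean sigma n (fun c => f c + g c) =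
  source_mean sigma n f + source_mean sigma n g.
Proof. by rewrite -big_split; apply: eq_bigr => c _; rewrite mulrDr. Qed.

Lemma source_meanZ sigma n (k : R) f :
  source_mean sigma n (fun c => k * f c) = k * source_mean sigma n f.
Proof. by rewrite big_distrr; apply: eq_bigr => c _; rewrite mulrCA. Qed.

Lemma le_source_mean sigma n f g :
  (forall c, f c <= g c) -> source_mean sigma n f <= source_mean sigma n g.
Proof.
by move=> fg; apply: ler_sum => c _; rewrite ler_wpM2l ?source_law_ge0.
Qed.

(** * Distance of the output bit from uniform *)

Lemma output_law_mean sigma n (G : seq C -> bool) (b : bool) :
  output_law p sigma (fun c : n.-tuple C => G c) b =
  source_mean sigma n (fun c => (G c == b)%:R).
Proof.
rewrite /output_law big_mkcond; apply: eq_bigr => c _.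
by case: eqP => _; rewrite ?mulr1 ?mulr0.
Qed.

(** The deviations at [true] and [false] are opposite, which cancels the factor one half. *)
Lemma tv_distance_output sigma n (G : seq C -> bool) :
  tv_distance (output_law p sigma (fun c : n.-tuple C => G c))
    (@uniform_bit R) =
  `|source_mean sigma n (fun c => (G c)%:R) - 2^-1|.
Proof.
rewrite /tv_distance /uniform_bit big_bool /= !output_law_mean.
set m := source_mean _ _ (fun c => (G c)%:R).
have -> : source_mean sigma n (fun c => (G c == true)%:R) = m.
  by apply: eq_source_mean => c; rewrite eqb_id.
have -> : source_mean sigma n (fun c => (G c == false)%:R) = 1 - m.
  rewrite -[X in X - m](source_mean_cst sigma n 1) -mulN1r -source_meanZ -source_meanD.
  by apply: eq_source_mean => c; case: (G c) => /=; ring.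
have -> : 1 - m - 2^-1 = - (m - 2^-1) by field.
by rewrite normrN; field.
Qed.

(** * The stopped martingale and the bias of its sign *)

Section StoppedWalk.
Context (psi : C -> R) (a B v : R).

(** The test reads the value before the step, so the interval is overshot by at most one increment.
    The start [y] varies because the first-step recursion moves it. *)
Fixpoint stopped_walk (y : R) (c : seq C) : R :=
  if c is x :: c' then
    stopped_walk (if `|y| < a then y + psi x else y) c'
  else y.

Hypothesis psi_mean : forall s, expectation (p s) psi = 0.

Lemma stopped_walk_id y c : a <= `|y| -> stopped_walk y c = y.
Proof. by elim: c => //= x c IHc ay; rewrite ltNge ay IHc. Qed.

Lemma first_law_psi sigma : \sum_x first_law sigma x * psi x = 0.
Proof.
by rewrite first_law_mean big1 // => s _; rewrite psi_mean mulr0.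
Qed.

Lemma stopped_walk_mean sigma n y :
  source_mean sigma n (stopped_walk y) = y.
Proof.
elim: n sigma y => [|n IHn] sigma y; first exact: source_mean0.
rewrite source_meanS /=; under eq_bigr do rewrite IHn.
case: (ltP `|y| a) => _; last by rewrite -big_distrl /= first_law_sum1 mul1r.
under eq_bigr do rewrite mulrDr.
by rewrite big_split /= -big_distrl /= first_law_sum1 mul1r first_law_psi addr0.
Qed.

Hypothesis psi_le : forall x, `|psi x| <= B.
Hypothesis psi_var : forall s, v <= variance (p s) psi.

(** Since [psi] is centred under each [p s], its variance there is its second moment, and second
    moments average over the mixture. *)
Lemma first_law_psi2 sigma : v <= \sum_x first_law sigma x * psi x ^+ 2.
Proof.
rewrite first_law_mean -[v]mul1r -(pmf_sum1 (sigma [::])) big_distrl /=.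
apply: ler_sum => s _; rewrite ler_wpM2l ?pmf_ge0 //.
apply: le_trans (psi_var s) _; rewrite /variance psi_mean.
by rewrite le_eqVlt; apply/orP; left; apply/eqP/eq_bigr => x _; rewrite subr0.
Qed.

Lemma step_le y x : `|y| < a -> `|y + psi x| <= a + B.
Proof.
by move=> ya; rewrite (le_trans (ler_normD _ _)) ?lerD ?psi_le ?ltW.
Qed.

Lemma stopped_walk_le y c : `|y| <= a + B -> `|stopped_walk y c| <= a + B.
Proof.
elim: c y => //= x c IHc y yL; case: ifP => ya; apply: IHc => //.
exact: step_le.
Qed.

(** The right side is a nonnegative budget, of which each step taken while running consumes at least
    [v] on average. *)
Lemma running_mean_le sigma n y : 0 <= v -> `|y| <= a + B ->
  n%:R * v * source_mean sigma n (fun c => (`|stopped_walk y c| < a)%R%:R)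
    <= (a + B) ^+ 2 - y ^+ 2.
Proof.
move=> v0; set L := a + B.
have sqr_le z : `|z| <= L -> 0 <= L ^+ 2 - z ^+ 2.
  by move=> zL; rewrite subr_ge0 -real_normK ?num_real // lerXn2r ?nnegrE
    ?(le_trans _ zL).
elim: n sigma y => [|n IHn] sigma y yL; first by rewrite !mul0r sqr_le.
have [ay|ya] := leP a `|y|.
  rewrite (@eq_source_mean _ _ _ (fun=> 0)) => [|c].
    by rewrite source_mean_cst mulr0 sqr_le.
  by rewrite stopped_walk_id // ltNge ay.
rewrite -natr1 !mulrDl mul1r.
(* Of the [n.+1] copies of [v] times the running probability, one is bounded by [v] and paid for by
   the first step; the other [n] go to the induction hypothesis. *)
have running_le1 : v * source_mean sigma n.+1
    (fun c => (`|stopped_walk y c| < a)%R%:R) <= v.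
  rewrite -[leRHS]mulr1 ler_wpM2l // -[leRHS](source_mean_cst sigma n.+1).
  by apply: le_source_mean => c; rewrite lern1 leq_b1.
suff step : n%:R * v * source_mean sigma n.+1
    (fun c => (`|stopped_walk y c| < a)%R%:R) <= L ^+ 2 - y ^+ 2 - v.
  by rewrite -[leRHS](subrK v) lerD.
rewrite source_meanS big_distrr /= ya.
apply: (@le_trans _ _ (\sum_x first_law sigma x *
    (L ^+ 2 - (y + psi x) ^+ 2))).
  apply: ler_sum => x _; rewrite mulrCA ler_wpM2l ?first_law_ge0 //.
  by rewrite IHn // step_le.
(* In the expanded square the cross term has mean zero, and the last sum is at least [v]. *)
have -> : \sum_x first_law sigma x * (L ^+ 2 - (y + psi x) ^+ 2) =
    (\sum_x first_law sigma x) * (L ^+ 2 - y ^+ 2)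
    - 2 * y * (\sum_x first_law sigma x * psi x)
    - \sum_x first_law sigma x * psi x ^+ 2.
  rewrite big_distrl big_distrr /= -!sumrB; apply: eq_bigr => x _.
  by ring.
by rewrite first_law_sum1 first_law_psi mul1r mulr0 subr0 lerB ?first_law_psi2.
Qed.

End StoppedWalk.

(** The slope [1 / (2 * a + B)] balances the errors at [y = a] and [y = a + B]: both equal
    [B / (2 * (2 * a + B))], with opposite signs. For [|y| < a] the error is at most one half, which
    the indicator absorbs. *)
Lemma sign_affine_le (a B y : R) : 0 < a -> 0 < B -> `|y| <= a + B ->
  `|(0 < y)%R%:R - 2^-1 - y / (2 * a + B)|
    <= B / (2 * (2 * a + B)) + (`|y| < a)%R%:R.
Proof.
move=> a0 B0 yL; have D0 : 0 < 2 * a + B by lra.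
rewrite -(ler_pM2r (_ : 0 < 2 * (2 * a + B))); last lra.
rewrite -{1}[2 * (2 * a + B)]gtr0_norm -?normrM; last lra.
have -> : ((0 < y)%R%:R - 2^-1 - y / (2 * a + B)) * (2 * (2 * a + B)) =
    (0 < y)%R%:R * (2 * (2 * a + B)) - (2 * a + B) - 2 * y.
  by field; lra.
have -> : (B / (2 * (2 * a + B)) + (`|y| < a)%R%:R) * (2 * (2 * a + B)) =
    B + (`|y| < a)%R%:R * (2 * (2 * a + B)).
  by field; lra.
move: yL; rewrite ler_norml => /andP[yl yu].
rewrite ler_norml; case: (ltP `|y| a) => [|ya] /=.
  by rewrite ltr_norml => /andP[y1 y2]; case: (ltP 0 y) => y0 /=;
    apply/andP; split; lra.
by move: ya; rewrite ler_normr => /orP[] ya; case: (ltP 0 y) => y0 /=;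
  apply/andP; split; lra.
Qed.

(** The affine approximation of the sign has mean exactly one half, because the stopped walk has
    mean zero; only the averaged error remains. *)
Lemma stopped_walk_bias sigma (psi : C -> R) (a B v : R) n :
    (forall s, expectation (p s) psi = 0) ->
    (forall x, `|psi x| <= B) -> (forall s, v <= variance (p s) psi) ->
    0 < a -> 0 < B -> 0 < v -> (0 < n)%N ->
  `|source_mean sigma n (fun c => (0 < stopped_walk psi a 0 c)%R%:R) - 2^-1|
    <= B / (2 * (2 * a + B)) + (a + B) ^+ 2 / (n%:R * v).
Proof.
move=> mean0 psiB var_ge a0 B0 v0 n0.
set W := stopped_walk psi a 0; set D := 2 * a + B.
set e := B / (2 * D).
have W_le c : `|W c| <= a + B.
  by apply: stopped_walk_le => //; rewrite normr0; lra.
have run_le : source_mean sigma n (fun c => (`|W c| < a)%R%:R)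
    <= (a + B) ^+ 2 / (n%:R * v).
  rewrite ler_pdivlMr ?mulr_gt0 ?ltr0n // mulrC.
  have := @running_mean_le psi a B v mean0 psiB var_ge sigma n 0
    (ltW v0).
  by rewrite expr0n subr0 normr0; apply; lra.
apply: le_trans (_ : _ <= e + source_mean sigma n (fun c => (`|W c| < a)%R%:R)) _;
  last by rewrite lerD2l.
have centered : source_mean sigma n
    (fun c => (0 < W c)%R%:R + (- 2^-1 + - D^-1 * W c)) =
    source_mean sigma n (fun c => (0 < W c)%R%:R) - 2^-1.
  rewrite !source_meanD source_meanZ source_mean_cst stopped_walk_mean //.
  by rewrite mulr0 addr0.
(* Used with [k = -1] and [k = 1] for the two sides of the absolute value. *)
have envelope (k : R) : source_mean sigma n
    (fun c => k * (e + (`|W c| < a)%R%:R)) =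
    k * (e + source_mean sigma n (fun c => (`|W c| < a)%R%:R)).
  by rewrite source_meanZ source_meanD source_mean_cst.
have pointwise c := sign_affine_le a0 B0 (W_le c).
rewrite ler_norml -mulN1r -[X in _ && (_ <= X)]mul1r -!envelope -centered.
by apply/andP; split; apply: le_source_mean => c;
  have := pointwise c; rewrite ler_norml -/D -/e mulrC => /andP[]; lra.
Qed.

End SourceMean.

(** * Choice of the threshold and the length *)

Theorem theorem1 (R : realType) (C S : finType) (p : S -> fdist R C)
    (hpsi : exists psi : C -> R, forall s : S,
      expectation (p s) psi = 0 /\ 0 < variance (p s) psi) :
  deterministic_extraction_possible p.
Proof.
case: hpsi => psi psiP eps eps0.
(* The sum dominates every [|psi x|]; the added 1 keeps [B] positive. *)
pose B := 1 + \sum_x `|psi x|.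
have B0 : 0 < B by rewrite ltr_pwDl // sumr_ge0.
have psiB x : `|psi x| <= B.
  by rewrite /B (bigD1 x) //= addrCA lerDl addr_ge0 ?sumr_ge0.
(* The default 1 keeps [v] positive even for empty [S]. *)
pose v := \big[Num.min/1]_s variance (p s) psi.
have v0 : 0 < v by apply: lt_bigmin => [|s _]; [exact: ltr01 | case: (psiP s)].
have v_le s : v <= variance (p s) psi by exact: bigmin_le.
(* Then [B / (2 * (2 * a + B))] is below [B / (4 * a) = eps / 4]. *)
pose a := B / eps.
have a0 : 0 < a by rewrite divr_gt0.
(* Makes the running probability at most [eps / 2]; the successor ensures [0 < n]. *)
pose n := (Num.bound (2 * (a + B) ^+ 2 / (v * eps))).+1.
have n_ge : 2 * (a + B) ^+ 2 / (v * eps) <= n%:R.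
  have ratio_ge0 : 0 <= 2 * (a + B) ^+ 2 / (v * eps).
    by rewrite divr_ge0 // mulr_ge0 ?sqr_ge0 // ltW.
  by rewrite (le_trans (ltW (archi_boundP ratio_ge0))) ?ler_nat.
exists n, (fun c => 0 < stopped_walk psi a 0 c) => sigma.
rewrite (tv_distance_output p sigma n (fun c => 0 < stopped_walk psi a 0 c)).
apply: le_trans (stopped_walk_bias sigma _ psiB v_le a0 B0 v0 _) _ => //.
  by move=> s; case: (psiP s).
have sign_err : B / (2 * (2 * a + B)) <= eps / 2.
  rewrite ler_pdivrMr; last lra.
  have -> : B = a * eps by rewrite /a divfK ?gt_eqF.
  by have := mulr_gt0 (mulr_gt0 a0 eps0) eps0; have := mulr_gt0 a0 eps0; nra.
have run_err : (a + B) ^+ 2 / (n%:R * v) <= eps / 2.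
  rewrite ler_pdivrMr ?mulr_gt0 ?ltr0n //.
  by move: n_ge; rewrite ler_pdivrMr ?mulr_gt0 //; lra.
by rewrite [eps]splitr lerD.
Qed.
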